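(* Let $n \ge 1$, $\varepsilon > 0$, $\alpha \in (0,1]$ and $\beta_{\rm I}, \beta_{\rm II} \in (0,1)$, and set $\beta = \min(\beta_{\rm I}, \beta_{\rm II})$. For every (explicitly given) distribution $q$ over $[n]$ there exists an $(\varepsilon,0)$-differentially private algorithm for the $(\alpha, \beta_{\rm I}, \beta_{\rm II})$-identity testing problem with respect to $q$ which uses $$m = \tilde O\left(\max \left\{\frac{\sqrt{n}}{\alpha^2}, \frac{\sqrt{n}}{\alpha^{3/2}\varepsilon}, \frac{n^{1/3}}{\alpha^{5/3}\varepsilon^{2/3}}\right\} \cdot \log (1/\beta) \right)$$ samples from the unknown distribution $p$.
   Context: All distributions are discrete distributions over $[n]=\{1,\dots,n\}$; $p_i$ denotes the mass that $p$ places on $i$. The total variation distance is $d_{\mathrm{TV}}(p,q) = \frac12\sum_{i\in[n]}|p_i-q_i|$. A dataset of samples is identified with its vector of counts in $\mathbb{N}^n$. A randomized algorithm $M$ with domain $\mathbb{N}^n$ is $(\varepsilon,\delta)$-differentially private if for all measurable $S\subseteq \mathrm{Range}(M)$ and all pairs of inputs $D,D'$ with $\|D-D'\|_1\le 1$, $\Pr[M(D)\in S]\le e^{\varepsilon}\Pr[M(D')\in S]+\delta$; privacy must hold for every possible dataset, not only for samples from the two cases below. An algorithm for the $(\alpha,\beta_{\rm I},\beta_{\rm II})$-identity testing problem with respect to a known distribution $q$ takes $m$ samples from an unknown distribution $p$ and: if $p=q$, outputs ''$p=q$'' with probability at least $1-\beta_{\rm I}$; if $d_{\mathrm{TV}}(p,q)\ge\alpha$,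 outputs ''$p\neq q$'' with probability at least $1-\beta_{\rm II}$ (otherwise the output may be arbitrary). $\tilde O(\cdot)$ hides polylogarithmic factors (in $n$). *)

(* Defs.v *)
From HB Require Import structures.
From mathcomp Require Import all_boot all_order all_algebra.
From mathcomp Require Import all_classical all_reals all_analysis.
Set Implicit Arguments. Unset Strict Implicit. Unset Printing Implicit Defensive.
Import Order.TTheory GRing.Theory Num.Theory.
Local Open Scope ring_scope.

Section Defs.
Variable R : realType.

(* A distribution over [n] = 'I_n (i is identified with i+1). *)
Definition is_dist (n : nat) (p : {ffun 'I_n -> R}) : Prop :=
  (forall i, 0 <= p i) /\ \sum_i p i = 1.

Definition dTV (n : nat) (p q : {ffun 'I_n -> R}) : R :=
  2^-1 * \sum_i `|p i - q i|.

Definition counts (n m : nat) (x : {ffun 'I_m -> 'I_n}) : {ffun 'I_n -> nat} :=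
  [ffun i => #|[set j | x j == i]|].

Definition dist1 (n : nat) (D D' : {ffun 'I_n -> nat}) : nat :=
  \sum_i `|(D i)%:Z - (D' i)%:Z|%N.

(* A randomized algorithm on datasets N^n with output in bool
   (true = "p <> q", false = "p = q") is given by its output distribution
   on every input. *)
Definition randomized (n : nat) (M : {ffun 'I_n -> nat} -> {ffun bool -> R}) : Prop :=
  forall D, (forall o, 0 <= M D o) /\ \sum_o M D o = 1.

Definition diff_private (n : nat) (eps delta : R)
  (M : {ffun 'I_n -> nat} -> {ffun bool -> R}) : Prop :=
  forall (D D' : {ffun 'I_n -> nat}), (dist1 D D' <= 1)%N ->
  forall S : {set bool},
    \sum_(o in S) M D o <= expR eps * \sum_(o in S) M D' o + delta.

Definition prob_out (n m : nat) (p : {ffun 'I_n -> R})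
  (M : {ffun 'I_n -> nat} -> {ffun bool -> R}) (o : bool) : R :=
  \sum_(x : {ffun 'I_m -> 'I_n}) (\prod_(j < m) p (x j)) * M (counts x) o.

Definition identity_tester (n : nat) (q : {ffun 'I_n -> R}) (alpha betaI betaII : R)
  (m : nat) (M : {ffun 'I_n -> nat} -> {ffun bool -> R}) : Prop :=
  (prob_out m q M false >= 1 - betaI) /\
  (forall p : {ffun 'I_n -> R}, is_dist p -> dTV p q >= alpha ->
     prob_out m p M true >= 1 - betaII).

Definition sample_main (n : nat) (eps alpha : R) : R :=
  Num.max (Num.max (Num.sqrt n%:R / alpha ^+ 2)
                   (Num.sqrt n%:R / (powR alpha (3 / 2) * eps)))
          (powR n%:R (1 / 3) / (powR alpha (5 / 3) * powR eps (2 / 3))).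

End Defs.

(* Main.v *)
(* The first two terms of the maximum suffice.  A batch of 2m samples is split
   into halves X, Y; with N_i(X) the count of i in X, T_i = 8 m alpha sqrt(r_i),
   r_i = max(q_i, 1/n), and g_i the function N_i - m q_i clipped to [-T_i, T_i]
   and centred under q, take
     Z = sum_i g_i(X) g_i(Y) / r_i.
   Then E_p Z = sum_i a_i^2 / r_i with a_i = E_p g_i vanishes for p = q and is
   at least (m alpha)^2 / 2 when p is alpha-far (up to a small bias a_i is
   comparable to m |p_i - q_i|, unless this exceeds T_i / 2, in which case one
   coordinate is enough).  Efron-Stein bounds E (Z - E Z)^2, and clipping makes Z
   O(m alpha sqrt n)-Lipschitz in each sample.  Rescaling Z - tau and clipping
   it to [-1, 1] gives a score u with E_q e^u <= 3/4 and E_p e^-u <= 3/4.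
   Summing u over O(log (1/beta)) batches makes the bounds multiply, which
   gives the error probability; averaging over all orderings of the samples
   (Jensen) turns the sum into a function of the counts, eps-Lipschitz in the
   l1 distance; its McShane extension to all datasets, passed through the
   logistic function, is the private test. *)
Require Import Defs.
From HB Require Import structures.
From mathcomp Require Import all_boot all_order all_algebra.
From mathcomp Require Import all_classical all_reals all_analysis.
From mathcomp Require Import fingroup perm ring lra.
Import Order.TTheory GRing.Theory Num.Theory.
Local Open Scope ring_scope.
Set Implicit Arguments.
Unset Strict Implicit.
Unset Printing Implicit Defensive.

(** * Expectation and variance over i.i.d. samples; Efron-Stein inequality *)

Section IidExpectation.
Variables (R : realType) (T : finType) (p : T -> R).
Hypothesis p_ge0 : forall t, 0 <= p t.
Hypothesis p_sum1 : \sum_t p t = 1.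

(** Samples are integrated out one at a time, head first, so that facts about the product
    distribution follow by induction on [m]. *)
Fixpoint expect (m : nat) (F : seq T -> R) : R :=
  if m is m'.+1 then \sum_t p t * expect m' (fun s => F (t :: s)) else F [::].

Definition variance (m : nat) (F : seq T -> R) : R :=
  expect m (fun s => F s ^+ 2) - expect m F ^+ 2.

Lemma le_expect m (F G : seq T -> R) :
  (forall s, size s = m -> F s <= G s) -> expect m F <= expect m G.
Proof.
elim: m F G => [|m IH] F G FG /=; first exact: FG.
apply: ler_sum => t _; apply: ler_wpM2l => //.
by apply: IH => s sm; apply: FG => /=; rewrite sm.
Qed.

Lemma eq_expect m (F G : seq T -> R) :
  (forall s, size s = m -> F s = G s) -> expect m F = expect m G.
Proof.
elim: m F G => [|m IH] F G FG /=; first exact: FG.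
apply: eq_bigr => t _; congr (_ * _).
by apply: IH => s sm; apply: FG => /=; rewrite sm.
Qed.

Lemma expectD m (F G : seq T -> R) :
  expect m (fun s => F s + G s) = expect m F + expect m G.
Proof.
elim: m F G => //= m IH F G; rewrite -big_split /=.
by apply: eq_bigr => t _; rewrite IH mulrDr.
Qed.

Lemma expectZ m (c : R) (F : seq T -> R) :
  expect m (fun s => c * F s) = c * expect m F.
Proof.
elim: m F => //= m IH F; rewrite big_distrr /=.
by apply: eq_bigr => t _; rewrite IH mulrCA.
Qed.

Lemma expect_cst m (c : R) : expect m (fun _ => c) = c.
Proof.
elim: m => //= m IH; under eq_bigr do rewrite IH.
by rewrite -big_distrl /= p_sum1 mul1r.
Qed.

Lemma expectN m (F : seq T -> R) : expect m (fun s => - F s) = - expect m F.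
Proof.
rewrite -mulN1r -expectZ; apply: eq_expect => s _; by rewrite mulN1r.
Qed.

Lemma expectB m (F G : seq T -> R) :
  expect m (fun s => F s - G s) = expect m F - expect m G.
Proof. by rewrite expectD expectN. Qed.

Lemma expect_sum m (I : finType) (F : I -> seq T -> R) :
  expect m (fun s => \sum_i F i s) = \sum_i expect m (F i).
Proof.
elim: m F => //= m IH F; rewrite exchange_big /=.
by apply: eq_bigr => t _; rewrite IH big_distrr.
Qed.

Lemma expect_cat a b (F : seq T -> R) :
  expect (a + b) F = expect a (fun s => expect b (fun s' => F (s ++ s'))).
Proof. by elim: a F => //= a IH F; apply: eq_bigr => t _; rewrite IH. Qed.

Lemma expect_ge0 m (F : seq T -> R) :
  (forall s, size s = m -> 0 <= F s) -> 0 <= expect m F.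
Proof. by move=> F0; rewrite -(expect_cst m 0); exact: le_expect. Qed.

Lemma ler_norm_expect m (F : seq T -> R) :
  `|expect m F| <= expect m (fun s => `|F s|).
Proof.
rewrite ler_norml -expectN !le_expect // => s _; first exact: ler_norm.
by have := ler_norm (- F s); rewrite normrN lerNl.
Qed.

Lemma varianceE m (F : seq T -> R) (c : R) :
  expect m (fun s => (F s - c) ^+ 2) = variance m F + (expect m F - c) ^+ 2.
Proof.
have -> : expect m (fun s => (F s - c) ^+ 2)
    = expect m (fun s => F s ^+ 2) - 2 * c * expect m F + c ^+ 2.
  rewrite -(expect_cst m (c ^+ 2)) -expectZ -expectB -expectD.
  apply: eq_expect => s _; ring.
rewrite /variance; ring.
Qed.

Lemma variance_expect m (F : seq T -> R) :
  expect m (fun s => (F s - expect m F) ^+ 2) = variance m F.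
Proof. by rewrite varianceE subrr expr0n addr0. Qed.

Lemma variance_ge0 m (F : seq T -> R) : 0 <= variance m F.
Proof. by rewrite -variance_expect; apply: expect_ge0 => s _; apply: sqr_ge0. Qed.

Lemma sqr_expect_le m (F : seq T -> R) :
  expect m F ^+ 2 <= expect m (fun s => F s ^+ 2).
Proof. by rewrite -subr_ge0; exact: variance_ge0. Qed.

(* Efron-Stein step: resampling the head costs at most the second moment of
   the change caused by deleting it. *)
Lemma variance_cons m (F G : seq T -> R) :
  variance m.+1 F <= \sum_t p t * variance m (fun s => F (t :: s))
     + \sum_t p t * expect m (fun s => (F (t :: s) - G s) ^+ 2).
Proof.
set e := fun t => expect m (fun s => F (t :: s)).
have varE : variance m.+1 F = \sum_t p t * variance m (fun s => F (t :: s))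
    + (\sum_t p t * e t ^+ 2 - (\sum_t p t * e t) ^+ 2).
  rewrite /variance /= addrA; congr (_ - _); rewrite -big_split /=.
  by apply: eq_bigr => t _; rewrite -mulrDr subrK.
rewrite varE lerD2l; set g := expect m G.
apply: (@le_trans _ _ (\sum_t p t * (e t - g) ^+ 2)).
  have -> : \sum_t p t * (e t - g) ^+ 2
      = \sum_t p t * e t ^+ 2 - 2 * g * (\sum_t p t * e t) + g ^+ 2 * \sum_t p t.
    rewrite !big_distrr /= -sumrB -big_split /=; apply: eq_bigr => t _; ring.
  have := sqr_ge0 (\sum_t p t * e t - g); rewrite p_sum1; nra.
apply: ler_sum => t _; apply: ler_wpM2l => //.
by rewrite /e /g -expectB; exact: sqr_expect_le.
Qed.

(** Efron-Stein for sums of functions of the counts: deleting a sample of value [i] changes only the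
    [i]-th term, and there are [count_mem i s] such samples. At count 0 the factor 0 makes the value
    of [.-1] harmless. *)
Lemma variance_counts m (c : T -> nat -> R) :
  variance m (fun s => \sum_i c i (count_mem i s)) <=
  expect m (fun s => \sum_i (count_mem i s)%:R *
    (c i (count_mem i s) - c i (count_mem i s).-1) ^+ 2).
Proof.
elim: m c => [|m IH] c.
  rewrite /variance /= subrr; apply: sumr_ge0 => i _.
  by rewrite mulr_ge0 ?sqr_ge0.
apply: (le_trans (variance_cons m _ (fun s => \sum_i c i (count_mem i s)))).
rewrite /= -big_split /=; apply: ler_sum => t _; rewrite -mulrDr.
apply: ler_wpM2l => //.
(* Fixing the head [t] shifts the count of [t] by one, so the induction hypothesis is used for the
   shifted family. *)
set c' := fun i k => c i ((t == i) + k)%N.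
have IHc := IH c'; apply: (le_trans (lerD IHc (lexx _))).
rewrite -expectD; apply: le_expect => s _.
have -> : \sum_i c i (count_mem i (t :: s)) - \sum_i c i (count_mem i s)
    = c t (count_mem t s).+1 - c t (count_mem t s).
  rewrite -sumrB (bigD1 t) //= eqxx add1n big1 ?addr0 // => i.
  by rewrite eq_sym => /negPf ->; rewrite add0n subrr.
rewrite (bigD1 t) //= [X in _ <= X](bigD1 t) //= addrAC.
apply: lerD; last first.
  apply: ler_sum => i; rewrite eq_sym => /negPf ti.
  by rewrite /c' ti.
rewrite /c' eqxx !add1n /=; case: (count_mem t s) => [|k] /=.
  by rewrite mul0r add0r mul1r.
by rewrite [k.+2%:R]mulrS mulrDl mul1r addrC.
Qed.

End IidExpectation.

(** * Clipping to a symmetric interval *)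

Section Clip.
Variable R : realType.
Implicit Types T x y D V : R.

Definition clip T x : R := Num.max (- T) (Num.min T x).

Variant clip_spec T x : R -> Prop :=
| ClipMid of - T <= x & x <= T : clip_spec T x x
| ClipHigh of T < x : clip_spec T x T
| ClipLow of x < - T : clip_spec T x (- T).

Lemma clipP T x : 0 <= T -> clip_spec T x (clip T x).
Proof.
move=> T0; rewrite /clip; case: (ltP T x) => xT.
  by rewrite max_r; [exact: ClipHigh | lra].
by case: (leP (- T) x) => xT'; [exact: ClipMid | exact: ClipLow].
Qed.

Lemma ler_norm_clip T x : 0 <= T -> `|clip T x| <= T.
Proof. by move=> T0; rewrite ler_norml; case: (clipP x T0) => *; lra. Qed.

Lemma clip_lip T x y : 0 <= T -> `|clip T x - clip T y| <= `|x - y|.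
Proof.
move=> T0; rewrite ler_norml; case: (ler0P (x - y)) => xy;
  by case: (clipP x T0) => *; case: (clipP y T0) => *; lra.
Qed.

Lemma clip_high T x : 0 <= T -> T <= x -> clip T x = T.
Proof. by move=> T0; case: (clipP x T0) => *; lra. Qed.

(** Beyond the cutoff the error is [|x| - T], and [(|x| - 2T)^2 >= 0] makes it quadratic, so a
    second moment controls the bias of clipping. *)
Lemma clip_err T x : 0 < T -> `|clip T x - x| <= x ^+ 2 / (4 * T).
Proof.
move=> T0; have T4 : 0 < 4 * T by lra.
have sq1 := sqr_ge0 (x - 2 * T); have sq2 := sqr_ge0 (x + 2 * T).
have := sqr_ge0 x.
rewrite ler_pdivlMr //; case: (clipP x (ltW T0)) => [_ _|xT|xT].
- by rewrite subrr normr0 mul0r.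
- by rewrite ltr0_norm; [nra | lra].
- by rewrite gtr0_norm; [nra | lra].
Qed.

(** A pointwise Chebyshev bound: if [x < T / 4 <= D / 2], then [x] is at least [D / 2] away from
    [D], the penalty is at least [5 * T / 4], and the left side drops to at most [- T]. *)
Lemma clip_lower T D x : 0 < T -> T <= 2 * D ->
  T / 4 - 5 * T / D ^+ 2 * (x - D) ^+ 2 <= clip T x.
Proof.
move=> T0 TD; have D0 : 0 < D by lra.
have K0 : 0 <= 5 * T / D ^+ 2 by rewrite divr_ge0 ?sqr_ge0 //; lra.
have E0 := mulr_ge0 K0 (sqr_ge0 (x - D)).
case: (ltP x (T / 4)) => xT; last by case: (clipP x (ltW T0)) => *; lra.
suff : 5 * T / 4 <= 5 * T / D ^+ 2 * (x - D) ^+ 2.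
  by case: (clipP x (ltW T0)) => *; lra.
rewrite [leRHS]mulrAC ler_pdivlMr ?exprn_gt0 //.
have -> : 5 * T / 4 * D ^+ 2 = 5 * T * (D / 2) ^+ 2 by field.
by apply: ler_wpM2l; [lra | nra].
Qed.

Lemma clipN T x : 0 <= T -> clip T (- x) = - clip T x.
Proof. by move=> T0; case: (clipP x T0) => *; case: (clipP _ T0) => *; lra. Qed.

End Clip.

(** * Moments of a clipped count *)

Section ClippedCount.
Variables (R : realType) (I : finType).
Implicit Types (p q : I -> R) (T : R).

Lemma expect_count p m i : \sum_t p t = 1 ->
  expect p m (fun s => (count_mem i s)%:R) = m%:R * p i.
Proof.
move=> p1; elim: m => [|m IH] /=; first by rewrite mul0r.
have -> : \sum_t p t * expect p m (fun s => ((t == i) + count_mem i s)%:R)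
   = \sum_t (p t * (t == i)%:R + p t * (m%:R * p i)).
  apply: eq_bigr => t _; rewrite -mulrDr -IH; congr (_ * _).
  rewrite -[X in X + _](expect_cst p1 m) -expectD.
  by congr expect; apply/funext => s; rewrite natrD.
rewrite big_split /= -big_distrl /= p1 mul1r (bigD1 i) //= eqxx mulr1 big1.
  by rewrite addr0 mulrS mulrDl mul1r.
by move=> t /negPf ->; rewrite mulr0.
Qed.

Lemma variance_count1 p m i (c : nat -> R) :
  (forall t, 0 <= p t) -> \sum_t p t = 1 ->
  variance p m (fun s => c (count_mem i s)) <=
  expect p m (fun s => (count_mem i s)%:R *
    (c (count_mem i s) - c (count_mem i s).-1) ^+ 2).
Proof.
move=> p0 p1.
have sum1 (F : I -> R) : \sum_j (j == i)%:R * F j = F i.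
  rewrite (bigD1 i) //= eqxx mul1r big1 ?addr0 // => j /negPf ->.
  by rewrite mul0r.
have := variance_counts p0 p1 m (fun j k => (j == i)%:R * c k).
rewrite /variance.
under [X in expect p m X - _]funext do rewrite sum1.
under [X in _ - expect p m X ^+ 2]funext do rewrite sum1.
move/le_trans; apply; apply: le_expect => // s _.
have E j : (count_mem j s)%:R * ((j == i)%:R * c (count_mem j s) -
    (j == i)%:R * c (count_mem j s).-1) ^+ 2 = (j == i)%:R * ((count_mem j s)%:R *
    (c (count_mem j s) - c (count_mem j s).-1) ^+ 2).
  by case: (j == i); rewrite !(mul1r, mul0r) // subrr expr0n mulr0.
by under eq_bigr do rewrite E; rewrite sum1.
Qed.

Definition clipped T (x : R) (k : nat) : R := clip T (k%:R - x).

Definition clipped_mean p m i T (x : R) : R :=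
  expect p m (fun s => clipped T x (count_mem i s)).

(** The Efron-Stein upper bound on the variance of the clipped count, not the variance itself. *)
Definition clipped_var p m i T (x : R) : R :=
  expect p m (fun s => (count_mem i s)%:R * (clipped T x (count_mem i s)
    - clipped T x (count_mem i s).-1) ^+ 2).

Section Moments.
Variables (p : I -> R) (m : nat) (i : I).
Hypotheses (p_ge0 : forall t, 0 <= p t) (p_sum1 : \sum_t p t = 1).
Variables (T x : R).
Hypotheses (T_gt0 : 0 < T) (x_ge0 : 0 <= x).
Let D := m%:R * p i - x.

Lemma count_sqr_dev y :
  expect p m (fun s => ((count_mem i s)%:R - y) ^+ 2) <=
  m%:R * p i + (m%:R * p i - y) ^+ 2.
Proof.
rewrite varianceE // expect_count // lerD2r.
apply: (le_trans (variance_count1 m i (fun k => k%:R) p_ge0 p_sum1)).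
rewrite -(expect_count m i p_sum1); apply: le_expect => // s _.
case: (count_mem i s) => [|k] /=; first by rewrite mul0r.
by rewrite [X in X - _]mulrS addrK expr1n mulr1.
Qed.

Lemma clipped_mean_err :
  `|clipped_mean p m i T x - D| <= (m%:R * p i + D ^+ 2) / (4 * T).
Proof.
have -> : clipped_mean p m i T x - D = expect p m (fun s =>
    clipped T x (count_mem i s) - ((count_mem i s)%:R - x)).
  by rewrite !expectB expect_count // expect_cst.
apply: (le_trans (ler_norm_expect p_ge0 _ _)).
apply: (@le_trans _ _ ((4 * T)^-1 *
    expect p m (fun s => ((count_mem i s)%:R - x) ^+ 2))); last first.
  rewrite mulrC; apply: ler_wpM2r; last exact: count_sqr_dev.
  by rewrite invr_ge0 mulr_ge0 // ltW.
rewrite -expectZ; apply: le_expect => // s _.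
by rewrite mulrC; apply: clip_err.
Qed.

Lemma clipped_mean_lower : T <= 2 * D ->
  T / 4 - 5 * T / D ^+ 2 * (m%:R * p i) <= clipped_mean p m i T x.
Proof.
move=> TD; apply: (@le_trans _ _ (expect p m (fun s => T / 4 -
  5 * T / D ^+ 2 * ((count_mem i s)%:R - m%:R * p i) ^+ 2))); last first.
  apply: le_expect => // s _.
  have := clip_lower ((count_mem i s)%:R - x) T_gt0 TD.
  by rewrite /clipped /D (_ : _ - x - _ = (count_mem i s)%:R - m%:R * p i) //; ring.
rewrite expectB expect_cst // expectZ lerD2l lerN2.
apply: ler_wpM2l; first by rewrite divr_ge0 ?sqr_ge0 ?mulr_ge0 // ltW.
by apply: (le_trans (count_sqr_dev _)); rewrite subrr expr0n addr0.
Qed.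

Lemma clipped_mean_upper : 2 * D <= - T ->
  clipped_mean p m i T x <= - (T / 4 - 5 * T / D ^+ 2 * (m%:R * p i)).
Proof.
move=> TD; rewrite lerNr.
apply: (@le_trans _ _ (expect p m (fun s => T / 4 -
  5 * T / D ^+ 2 * ((count_mem i s)%:R - m%:R * p i) ^+ 2))); last first.
  rewrite -expectN; apply: le_expect => // s _.
  have TD' : T <= 2 * - D by lra.
  have := clip_lower (- ((count_mem i s)%:R - x)) T_gt0 TD'.
  rewrite (clipN _ (ltW T_gt0)) (_ : - _ - - D = - ((count_mem i s)%:R - m%:R * p i)).
    by rewrite !sqrrN.
  rewrite /D; ring.
rewrite expectB expect_cst // expectZ lerD2l lerN2.
apply: ler_wpM2l; first by rewrite divr_ge0 ?sqr_ge0 ?mulr_ge0 // ltW.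
by apply: (le_trans (count_sqr_dev _)); rewrite subrr expr0n addr0.
Qed.

(** A step has size at most 1 and vanishes once [k - 1] reaches [x + T], where both values are
    clipped to [T]; hence the second bound holds however large [k] is. *)
Lemma clipped_step k : k%:R * (clipped T x k - clipped T x k.-1) ^+ 2 <= k%:R /\
  k%:R * (clipped T x k - clipped T x k.-1) ^+ 2 <= x + T + 1.
Proof.
have T0 := ltW T_gt0; have x0 := x_ge0; case: k => [|k] /=.
  by rewrite mul0r; split=> //; lra.
have k1 : k.+1%:R = 1 + k%:R :> R by rewrite mulrS.
have sq1 : (clipped T x k.+1 - clipped T x k) ^+ 2 <= 1.
  rewrite -real_normK ?num_real // expr_le1 //.
  apply: (le_trans (clip_lip _ _ T0)).
  by rewrite (_ : _ - _ - _ = 1) ?normr1 // k1; ring.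
have kk : 0 <= k%:R :> R by [].
split; first by rewrite ler_piMr.
case: (leP (x + T) k%:R) => kx.
  by rewrite /clipped !clip_high ?subrr ?expr0n ?mulr0 //; lra.
by apply: (@le_trans _ _ k.+1%:R); [rewrite ler_piMr | rewrite k1; lra].
Qed.

Lemma clipped_var_le : clipped_var p m i T x <= m%:R * p i /\
  clipped_var p m i T x <= x + T + 1.
Proof.
split.
  rewrite -(expect_count m i p_sum1); apply: le_expect => // s _.
  exact: (clipped_step _).1.
rewrite -[leRHS](expect_cst p_sum1 m); apply: le_expect => // s _.
exact: (clipped_step _).2.
Qed.

Lemma clipped_var_ge0 : 0 <= clipped_var p m i T x.
Proof. by apply: expect_ge0 => // s _; rewrite mulr_ge0 ?sqr_ge0. Qed.

End Moments.

(** * Shift of the clipped mean between two distributions *)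

Section Gap.
Variables (p q : I -> R) (m : nat) (i : I) (T : R).
Hypotheses (p_ge0 : forall t, 0 <= p t) (p_sum1 : \sum_t p t = 1).
Hypotheses (q_ge0 : forall t, 0 <= q t) (q_sum1 : \sum_t q t = 1).
Let x := m%:R * q i.
Let D := m%:R * p i - x.
Definition mean_gap : R := clipped_mean p m i T x - clipped_mean q m i T x.
Hypotheses (T_ge : 512 <= T) (x_le : x <= T ^+ 2 / 1024).

Let x_ge0 : 0 <= x. Proof. by rewrite /x mulr_ge0. Qed.
Let T_gt0 : 0 < T. Proof. by apply: lt_le_trans T_ge. Qed.

Let null_bias : `|clipped_mean q m i T x| <= x / (4 * T).
Proof.
have := clipped_mean_err m i q_ge0 q_sum1 x T_gt0.
by rewrite -/x subrr subr0 expr0n addr0.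
Qed.

(** Clipping under [p] costs at most [x / (4 * T)] plus [3 / 8] of [|D|], because
    [D^2 <= |D| * T / 2]; clipping under [q] costs another [x / (4 * T)]. *)
Lemma mean_gap_light : `|D| <= T / 2 ->
  5 / 8 * `|D| - x / (2 * T) <= `|mean_gap|.
Proof.
have T512 := T_ge; have T0 := T_gt0; have nb := null_bias; have x0 := x_ge0.
move=> DT; have errp := clipped_mean_err m i p_ge0 p_sum1 x T_gt0.
have {}errp : `|clipped_mean p m i T x - D| <= x / (4 * T) + 3 / 8 * `|D|.
  apply: (le_trans errp); rewrite -/x -/D ler_pdivrMr; last lra.
  rewrite mulrDl divfK; last lra.
  have -> : m%:R * p i = x + D by rewrite /D; ring.
  rewrite -[D ^+ 2]ger0_norm ?sqr_ge0 // normrX.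
  have := ler_norm D; have := normr_ge0 D; nra.
have -> : x / (2 * T) = x / (4 * T) + x / (4 * T) by field; lra.
have : `|D| <= `|mean_gap| + `|clipped_mean p m i T x - D| + `|clipped_mean q m i T x|.
  rewrite {1}(_ : D = mean_gap - (clipped_mean p m i T x - D) + clipped_mean q m i T x).
    by apply: (le_trans (ler_normD _ _)); rewrite lerD2r ler_normB.
  rewrite /mean_gap; ring.
lra.
Qed.

(** Here [m p_i <= x + |D|] is at most [D^2 / 80], so the clipped mean under [p] is at least
    [3 T / 16] in absolute value, and the bias [T / 4096] under [q] is negligible. *)
Lemma mean_gap_heavy : T / 2 < `|D| -> T / 8 <= `|mean_gap|.
Proof.
have T512 := T_ge; have T0 := T_gt0; have x0 := x_ge0; have xT := x_le.
move=> DT; have nb : `|clipped_mean q m i T x| <= T / 4096.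
  apply: (le_trans null_bias); rewrite ler_pdivrMr; last lra.
  by rewrite (_ : T / 4096 * _ = T ^+ 2 / 1024) //; field.
have small : 5 * T / D ^+ 2 * (m%:R * p i) <= T / 16.
  have D0 : 0 < `|D| by lra.
  rewrite -[D ^+ 2]ger0_norm ?sqr_ge0 // normrX mulrAC ler_pdivrMr ?exprn_gt0 //.
  have mpD : m%:R * p i <= x + `|D| by rewrite -lerBlDl; exact: ler_norm.
  have D1 : 256 * `|D| <= `|D| ^+ 2 by nra.
  have D2 : T ^+ 2 <= 4 * `|D| ^+ 2 by nra.
  have -> : T / 16 * `|D| ^+ 2 = 5 * T * (`|D| ^+ 2 / 80) by field.
  by apply: ler_wpM2l; lra.
have nb1 := le_trans (ler_norm _) nb.
have nb2 : - clipped_mean q m i T x <= T / 4096.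
  by apply: le_trans nb; rewrite ler_normr lexx orbT.
move: DT; case: (ler0P D) => D0 DT.
  have lo : 2 * (m%:R * p i - x) <= - T by rewrite -/D; lra.
  have := clipped_mean_upper p_ge0 p_sum1 T_gt0 lo; rewrite -/D => up.
  by rewrite ler_normr; apply/orP; right; rewrite /mean_gap; lra.
have lo : T <= 2 * (m%:R * p i - x) by rewrite -/D; lra.
have := clipped_mean_lower p_ge0 p_sum1 T_gt0 lo; rewrite -/D => up.
by apply: le_trans (ler_norm _); rewrite /mean_gap; lra.
Qed.

(** Bounds the noise by the null mean and the signal itself: a light coordinate uses the bound
    [m p_i = x + D], a heavy one the bound [x + T + 1], where [T <= 8 * |mean_gap|]. *)
Lemma clipped_var_gap : clipped_var p m i T x <= 2 * x + 16 * `|mean_gap|.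
Proof.
have T512 := T_ge; have T0 := T_gt0; have x0 := x_ge0.
have [v1 v2] := clipped_var_le m i p_ge0 p_sum1 T_gt0 x_ge0.
case: (leP `|D| (T / 2)) => DT; last by have := mean_gap_heavy DT; lra.
have := mean_gap_light DT; have := ler_norm D; rewrite {1}/D => Dl.
have := normr_ge0 mean_gap.
have : x / (2 * T) <= x / 8.
  by apply: ler_wpM2l => //; rewrite lef_pV2 ?posrE; lra.
lra.
Qed.

End Gap.
End ClippedCount.

(** * The product statistic of two independent halves *)

Section PairStatistic.
Variables (R : realType) (I : finType) (p : I -> R) (m : nat).
Hypotheses (p_ge0 : forall t, 0 <= p t) (p_sum1 : \sum_t p t = 1).
Variables (w : I -> R) (g : I -> nat -> R).

Definition pair_stat (s s' : seq I) : R :=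
  \sum_i w i * (g i (count_mem i s) * g i (count_mem i s')).

Let a i := expect p m (fun s => g i (count_mem i s)).
Let v i := expect p m (fun s => (count_mem i s)%:R *
  (g i (count_mem i s) - g i (count_mem i s).-1) ^+ 2).

Lemma variance_weighted (u : I -> R) :
  expect p m (fun s => (\sum_i u i * (g i (count_mem i s) - a i)) ^+ 2)
  <= \sum_i u i ^+ 2 * v i.
Proof.
have mean : expect p m (fun s => \sum_i u i * g i (count_mem i s))
    = \sum_i u i * a i.
  by rewrite expect_sum; apply: eq_bigr => i _; rewrite expectZ.
have -> : expect p m (fun s => (\sum_i u i * (g i (count_mem i s) - a i)) ^+ 2)
    = variance p m (fun s => \sum_i u i * g i (count_mem i s)).
  rewrite -variance_expect // mean; apply: eq_expect => s _.
  by rewrite -sumrB; congr (_ ^+ 2); apply: eq_bigr => i _; rewrite mulrBr.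
apply: (le_trans (variance_counts p_ge0 p_sum1 m (fun i k => u i * g i k))).
rewrite expect_sum; apply: ler_sum => i _; rewrite -expectZ.
by apply: le_expect => // s _; rewrite -mulrBr exprMn mulrCA.
Qed.

Lemma pair_stat_dev :
  expect p m (fun s => expect p m (fun s' =>
    (pair_stat s s' - \sum_i w i * a i ^+ 2) ^+ 2)) <=
  2 * (\sum_i (w i * v i) ^+ 2) + 4 * (\sum_i (w i * a i) ^+ 2 * v i).
Proof.
have v_ge0 i : 0 <= v i.
  by apply: expect_ge0 => // s _; rewrite mulr_ge0 ?sqr_ge0.
(* For a fixed first half, [A] is a centred linear statistic of the second half; [B] is one of the
   first half. [variance_weighted] bounds both. *)
pose A s s' := \sum_i (w i * g i (count_mem i s)) * (g i (count_mem i s') - a i).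
pose B s := \sum_i (w i * a i) * (g i (count_mem i s) - a i).
have split s s' : pair_stat s s' - \sum_i w i * a i ^+ 2 = A s s' + B s.
  rewrite /pair_stat /A /B -sumrB -big_split /=.
  by apply: eq_bigr => i _; ring.
apply: (@le_trans _ _ (expect p m (fun s =>
    2 * (\sum_i (w i * g i (count_mem i s)) ^+ 2 * v i) + 2 * B s ^+ 2))).
  apply: le_expect => // s _.
  apply: (@le_trans _ _ (expect p m (fun s' => 2 * A s s' ^+ 2 + 2 * B s ^+ 2))).
    apply: le_expect => // s' _; rewrite split.
    have := sqr_ge0 (A s s' - B s); nra.
  rewrite expectD expectZ expect_cst // lerD2r ler_pM2l //.
  exact: variance_weighted.
rewrite expectD !expectZ expect_sum.
(* The random weights in [A] are averaged out by [E g^2 <= v + a^2]. *)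
have sq i : expect p m (fun s => (w i * g i (count_mem i s)) ^+ 2 * v i)
    <= (w i * v i) ^+ 2 + (w i * a i) ^+ 2 * v i.
  have -> : expect p m (fun s => (w i * g i (count_mem i s)) ^+ 2 * v i) =
      w i ^+ 2 * v i * expect p m (fun s => (g i (count_mem i s)) ^+ 2).
    by rewrite -expectZ; apply: eq_expect => s _; ring.
  have -> : (w i * v i) ^+ 2 + (w i * a i) ^+ 2 * v i
      = w i ^+ 2 * v i * (v i + a i ^+ 2) by ring.
  apply: ler_wpM2l; first by rewrite mulr_ge0 ?sqr_ge0.
  by have := variance_count1 m i (g i) p_ge0 p_sum1; rewrite /variance lerBlDr.
have Bv := variance_weighted (fun i => w i * a i).
have : \sum_i expect p m (fun s => (w i * g i (count_mem i s)) ^+ 2 * v i)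
    <= \sum_i (w i * v i) ^+ 2 + \sum_i (w i * a i) ^+ 2 * v i.
  by rewrite -big_split; apply: ler_sum.
move: Bv; rewrite /B; lra.
Qed.

End PairStatistic.

(** * Hamming distance of sample sequences *)

Section Hamming.
Variable T : eqType.

Definition hamming (s s' : seq T) : nat :=
  count (fun xy => xy.1 != xy.2) (zip s s').

Lemma hamming_cat k (s s' : seq T) : size s = size s' ->
  hamming s s' = (hamming (take k s) (take k s') + hamming (drop k s) (drop k s'))%N.
Proof.
move=> ss; rewrite /hamming -count_cat -zip_cat ?cat_take_drop //.
by rewrite !size_take ss.
Qed.

End Hamming.

(** Replacing one sample lowers one count and raises another, whence the factor 2. *)
Lemma count_hamming (R : realType) (I : finType) (s s' : seq I) :
  size s = size s' ->
  \sum_i `|(count_mem i s)%:R - (count_mem i s')%:R| <= 2 * (hamming s s')%:R :> R.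
Proof.
elim: s s' => [|x s IH] [|y s'] //=.
  by move=> _; rewrite mulr0 big1 // => i _; rewrite subrr normr0.
move=> [ss]; rewrite /hamming /= natrD mulrDr -/(hamming s s').
apply: le_trans (lerD (lexx _) (IH s' ss)).
have step i : `|((x == i) + count_mem i s)%:R - ((y == i) + count_mem i s')%:R| <=
   `|(x == i)%:R - (y == i)%:R| + `|(count_mem i s)%:R - (count_mem i s')%:R| :> R.
  apply: le_trans (ler_normD _ _); rewrite !natrD le_eqVlt; apply/orP; left.
  by apply/eqP; congr `|_|; ring.
apply: (le_trans (ler_sum _ (fun i _ => step i))); rewrite big_split /= lerD2r.
case: (eqVneq x y) => [->|xy] /=.
  by rewrite mulr0 big1 // => i _; rewrite subrr normr0.
rewrite mulr1; apply: (@le_trans _ _ (\sum_i ((x == i)%:R + (y == i)%:R))).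
  apply: ler_sum => i _; apply: (le_trans (ler_normB _ _)).
  by rewrite !ger0_norm.
have one z : \sum_i (z == i)%:R = 1 :> R.
  by rewrite (bigD1 z) //= eqxx big1 ?addr0 // => i; rewrite eq_sym => /negPf ->.
by rewrite big_split /= !one.
Qed.

(** * The batch statistic: signal and deviation *)

Section BatchStatistic.
Variables (R : realType) (I : finType) (q : I -> R) (m : nat) (alpha : R).
Hypotheses (q_ge0 : forall t, 0 <= q t) (q_sum1 : \sum_t q t = 1).
Hypotheses (alpha_gt0 : 0 < alpha) (alpha_le1 : alpha <= 1).

Definition root_card : R := Num.sqrt #|I|%:R.
(** The floor [1 / n] keeps the weights [(root_mass i ^+ 2)^-1] at most [n], while the squares still
    sum to at most 2. *)
Definition root_mass (i : I) : R := Num.sqrt (Num.max (q i) #|I|%:R^-1).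
Definition strength : R := m%:R * alpha.
Definition cutoff (i : I) : R := 8 * strength * root_mass i.
(** Clipping may bias the mean even under [q]; subtracting that mean makes the statistic exactly
    centred in the null case. *)
Definition centered (i : I) (k : nat) : R :=
  clipped (cutoff i) (m%:R * q i) k
  - clipped_mean q m i (cutoff i) (m%:R * q i).
Definition batch_stat : seq I -> seq I -> R :=
  pair_stat (fun i => (root_mass i ^+ 2)^-1) centered.

Hypothesis m_large : 2 ^+ 15 * root_card <= m%:R * alpha ^+ 2.

Local Notation sn := root_card.
Local Notation rho := root_mass.
Local Notation A := strength.

Lemma card_gt0 : (0 < #|I|)%N.
Proof.
rewrite lt0n; apply/negP => /eqP/card0_eq I0; have := q_sum1.
rewrite big_pred0; first by move/eqP; rewrite eq_sym oner_eq0.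
exact: I0.
Qed.

Lemma root_card_ge1 : 1 <= sn.
Proof. by rewrite -sqrtr1 ler_sqrt // ler1n card_gt0. Qed.

Lemma root_card_sqr : sn ^+ 2 = #|I|%:R.
Proof. by rewrite sqr_sqrtr. Qed.

Lemma root_mass_sqr i : rho i ^+ 2 = Num.max (q i) #|I|%:R^-1.
Proof. by rewrite sqr_sqrtr // le_max q_ge0. Qed.

Lemma mass_le i : q i <= rho i ^+ 2.
Proof. by rewrite root_mass_sqr le_max lexx. Qed.

Lemma root_mass_gt0 i : 0 < rho i.
Proof.
by rewrite sqrtr_gt0 lt_max; apply/orP; right; rewrite invr_gt0 ltr0n card_gt0.
Qed.

Lemma root_mass_card i : 1 <= rho i * sn.
Proof.
have n0 : 0 < #|I|%:R :> R by rewrite ltr0n card_gt0.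
rewrite /root_mass /root_card -sqrtrM ?le_max ?q_ge0 // -{1}sqrtr1.
have h : 1 <= Num.max (q i) #|I|%:R^-1 * #|I|%:R.
  by rewrite -ler_pdivrMr // mul1r le_max lexx orbT.
by rewrite ler_sqrt ?(le_trans ler01 h).
Qed.

Lemma sum_root_mass : \sum_i rho i ^+ 2 <= 2.
Proof.
apply: (@le_trans _ _ (\sum_i (q i + #|I|%:R^-1))).
  apply: ler_sum => i _; rewrite root_mass_sqr ge_max lerDl lerDr q_ge0 andbT.
  by rewrite invr_ge0.
rewrite big_split /= q_sum1 sumr_const -[_ *+ #|_|]mulr_natl mulfV //
  ?pnatr_eq0 -?lt0n ?card_gt0 //.
Qed.

Lemma strength_ge : 2 ^+ 15 * sn <= A * alpha.
Proof. by rewrite /strength -mulrA -expr2. Qed.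

Lemma strength_sqr : A ^+ 2 = m%:R * (A * alpha).
Proof. by rewrite /strength; ring. Qed.

Lemma strength_ge_card : 2 ^+ 15 * sn <= A.
Proof.
apply: (le_trans strength_ge); rewrite ler_piMr //.
by rewrite mulr_ge0 // ltW.
Qed.

Lemma cutoff_ge i : 512 <= cutoff i.
Proof.
have rho1 := root_mass_card i; have rho0 := root_mass_gt0 i.
have sA := strength_ge_card; have sn1 := root_card_ge1.
have : 2 ^+ 15 * (rho i * sn) <= A * rho i.
  by rewrite [rho i * _]mulrC mulrA ler_pM2r.
rewrite /cutoff -mulrA; lra.
Qed.

Lemma cutoff_large i : m%:R * q i <= cutoff i ^+ 2 / 1024.
Proof.
have -> : cutoff i ^+ 2 / 1024 = (A ^+ 2 / 16) * rho i ^+ 2.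
  by rewrite /cutoff; field.
apply: ler_pM => //; last exact: mass_le.
have sA := strength_ge; have sn1 := root_card_ge1.
rewrite strength_sqr -mulrA ler_peMr //; lra.
Qed.

Section Alternative.
Variable p : I -> R.
Hypotheses (p_ge0 : forall t, 0 <= p t) (p_sum1 : \sum_t p t = 1).

Local Notation a i := (mean_gap p q m i (cutoff i)).

Definition signal : R := \sum_i (rho i ^+ 2)^-1 * a i ^+ 2.

Lemma centered_mean i : expect p m (fun s => centered i (count_mem i s)) = a i.
Proof. by rewrite expectB expect_cst. Qed.

Lemma signal_term_ge0 i : 0 <= (rho i ^+ 2)^-1 * a i ^+ 2.
Proof. by rewrite mulr_ge0 ?sqr_ge0 // invr_ge0 sqr_ge0. Qed.

Lemma signal_ge0 : 0 <= signal.
Proof. by apply: sumr_ge0 => i _; exact: signal_term_ge0. Qed.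

Lemma signal_term i : (rho i ^+ 2)^-1 * a i ^+ 2 <= signal.
Proof.
rewrite /signal (bigD1 i) //= lerDl; apply: sumr_ge0 => j _.
exact: signal_term_ge0.
Qed.

Lemma signal_large : 2 * alpha <= \sum_i `|p i - q i| -> A ^+ 2 / 2 <= signal.
Proof.
move=> far; have al0 := alpha_gt0; have sA := strength_ge; have sn1 := root_card_ge1.
have A1 := strength_ge_card; have A0 : 0 < A by lra.
(* One coordinate shifted by more than half its cutoff suffices: its gap is at least
   [cutoff i / 8 = A * rho i], so its term alone is at least [A ^+ 2]. *)
case: (pickP (fun i => cutoff i / 2 < `|m%:R * p i - m%:R * q i|)) => [i heavy|light].
  have gapT := mean_gap_heavy p_ge0 p_sum1 q_ge0 q_sum1 (cutoff_ge i)
    (cutoff_large i) heavy.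
  apply: le_trans (signal_term i); rewrite -[a i ^+ 2]real_normK ?num_real //.
  have rho0 := root_mass_gt0 i.
  rewrite [leRHS]mulrC ler_pdivlMr ?exprn_gt0 //.
  apply: (@le_trans _ _ ((cutoff i / 8) ^+ 2)).
    have -> : (cutoff i / 8) ^+ 2 = A ^+ 2 * rho i ^+ 2.
      by rewrite /cutoff; field.
    by rewrite ler_wpM2r ?sqr_ge0 //; have := sqr_ge0 A; lra.
  rewrite ler_pXn2r // nnegrE //.
  by have := cutoff_ge i; lra.
(* All coordinates are light. The square is replaced by a tangent, [a^2 / r >= A |a| - A^2 r / 4],
   so that the l1 distance can be summed. *)
have lower i : A * (5 / 8 * (m%:R * `|p i - q i|) - sn / (16 * alpha) * rho i ^+ 2)
    - A ^+ 2 / 4 * rho i ^+ 2 <= (rho i ^+ 2)^-1 * a i ^+ 2.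
  have rho0 := root_mass_gt0 i; have rho1 := root_mass_card i.
  have /negbT := light i; rewrite -leNgt => lighti.
  have := mean_gap_light p_ge0 p_sum1 q_ge0 q_sum1 (cutoff_ge i) lighti.
  rewrite -mulrBr normrM (ger0_norm (ler0n _ m)) => gapl.
  have bias : m%:R * q i / (2 * cutoff i) <= sn / (16 * alpha) * rho i ^+ 2.
    rewrite ler_pdivrMr; last by have := cutoff_ge i; lra.
    have -> : sn / (16 * alpha) * rho i ^+ 2 * (2 * cutoff i)
       = m%:R * rho i ^+ 2 * (rho i * sn).
      by rewrite /cutoff /strength; field; lra.
    apply: (@le_trans _ _ (m%:R * rho i ^+ 2)); last first.
      by rewrite ler_peMr // mulr_ge0 ?sqr_ge0.
    by rewrite ler_wpM2l // mass_le.
  have ineq : A * `|a i| - A ^+ 2 / 4 * rho i ^+ 2 <= (rho i ^+ 2)^-1 * a i ^+ 2.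
    rewrite -[a i ^+ 2]real_normK ?num_real // -subr_ge0.
    have -> : (rho i ^+ 2)^-1 * `|a i| ^+ 2 - (A * `|a i| - A ^+ 2 / 4 * rho i ^+ 2)
       = (`|a i| / rho i - A * rho i / 2) ^+ 2 by field; lra.
    exact: sqr_ge0.
  apply: (le_trans _ ineq); rewrite lerD2r ler_pM2l //; lra.
apply: le_trans (ler_sum _ (fun i _ => lower i)).
rewrite sumrB -!mulr_sumr sumrB -!mulr_sumr.
have far' : 2 * A <= m%:R * \sum_i `|p i - q i|.
  by rewrite /strength mulrCA; apply: ler_wpM2l.
have sr := sum_root_mass.
have bias : sn / (16 * alpha) * \sum_i rho i ^+ 2 <= A / 8.
  apply: (@le_trans _ _ (sn / (16 * alpha) * 2)).
    by apply: ler_wpM2l => //; rewrite divr_ge0 ?mulr_ge0 //; lra.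
  rewrite mulrAC ler_pdivrMr ?mulr_gt0 //; lra.
(* The total is at least [A^2 (5/4 - 1/8 - 1/2)]. *)
have A2 := sqr_ge0 A; nra.
Qed.

(** With [w = 1 / r], [q_i <= r_i] gives [w v_i <= 2 m + 16 w |a_i|]. The first part yields the null
    noise [m^2 n]; the second is absorbed through [w <= n] and [w a_i^2 <= signal]. *)
Lemma batch_stat_dev :
  expect p m (fun s => expect p m (fun s' => (batch_stat s s' - signal) ^+ 2)) <=
  16 * m%:R ^+ 2 * sn ^+ 2 + 2 ^+ 19 * sn ^+ 2 * signal + 8 * m%:R * signal
  + signal ^+ 2 / 256.
Proof.
pose w i := (rho i ^+ 2)^-1.
have := pair_stat_dev m p_ge0 p_sum1 w centered.
under [in leLHS]eq_bigr do rewrite centered_mean.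
have vE i : expect p m (fun s => (count_mem i s)%:R * (centered i (count_mem i s)
    - centered i (count_mem i s).-1) ^+ 2)
    = clipped_var p m i (cutoff i) (m%:R * q i).
  apply: eq_expect => s _; congr (_ * _ ^+ 2); rewrite /centered; ring.
under [X in _ <= 2 * X + _]eq_bigr do rewrite vE.
under [X in _ <= _ + 4 * X]eq_bigr do rewrite vE centered_mean.
move/le_trans; apply.
have w_gt0 i : 0 < w i by rewrite invr_gt0 exprn_gt0 // root_mass_gt0.
have w_le i : w i <= sn ^+ 2.
  rewrite /w -[X in X <= _]mul1r ler_pdivrMr ?exprn_gt0 ?root_mass_gt0 //.
  by rewrite mulrC -exprMn exprn_ege1 // root_mass_card.
have wv i : w i * clipped_var p m i (cutoff i) (m%:R * q i)
    <= 2 * m%:R + 16 * (w i * `|a i|).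
  have := clipped_var_gap p_ge0 p_sum1 q_ge0 q_sum1 (cutoff_ge i) (cutoff_large i).
  rewrite -(ler_pM2l (w_gt0 i)) => /le_trans; apply; rewrite mulrDr mulrCA.
  rewrite [w i * (16 * _)]mulrCA lerD2r ler_pM2l // mulrCA ler_piMr //.
  by rewrite /w mulrC ler_pdivrMr ?mul1r ?mass_le // exprn_gt0 // root_mass_gt0.
have wv0 i : 0 <= w i * clipped_var p m i (cutoff i) (m%:R * q i).
  by rewrite mulr_ge0 ?(ltW (w_gt0 i)) // clipped_var_ge0.
have t_ge0 i : 0 <= w i * a i ^+ 2 by exact: signal_term_ge0.
have bound1 i : (w i * clipped_var p m i (cutoff i) (m%:R * q i)) ^+ 2 <=
    8 * m%:R ^+ 2 + 512 * sn ^+ 2 * (w i * a i ^+ 2).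
  apply: (@le_trans _ _ ((2 * m%:R + 16 * (w i * `|a i|)) ^+ 2)).
    by rewrite ler_pXn2r // nnegrE ?(le_trans (wv0 i) (wv i)).
  have := ler_wpM2r (t_ge0 i) (w_le i).
  have -> : w i * (w i * a i ^+ 2) = (w i * `|a i|) ^+ 2.
    by rewrite -[a i ^+ 2]real_normK ?num_real //; ring.
  have := sqr_ge0 (2 * m%:R - 16 * (w i * `|a i|)); nra.
have bound2 i : (w i * a i) ^+ 2 * clipped_var p m i (cutoff i) (m%:R * q i) <=
    2 * m%:R * (w i * a i ^+ 2) + (2 ^+ 16 * sn ^+ 2) * (w i * a i ^+ 2)
    + signal / 1024 * (w i * a i ^+ 2).
  have -> : (w i * a i) ^+ 2 * clipped_var p m i (cutoff i) (m%:R * q i) =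
    (w i * a i ^+ 2) * (w i * clipped_var p m i (cutoff i) (m%:R * q i)) by ring.
  rewrite -!mulrDl [leRHS]mulrC; apply: ler_wpM2l => //.
  apply: (le_trans (wv i)); rewrite -addrA lerD2l.
  have := signal_term i; rewrite -/(w i) -[a i ^+ 2]real_normK ?num_real // => ts.
  have := w_le i; have := w_gt0 i.
  (* This square gives [16 w |a| <= w a^2 / 1024 + 2^16 w]. *)
  have := mulr_ge0 (ltW (w_gt0 i)) (sqr_ge0 (`|a i| / 32 - 256)).
  nra.
have sum1 : \sum_i (w i * clipped_var p m i (cutoff i) (m%:R * q i)) ^+ 2 <=
    8 * m%:R ^+ 2 * sn ^+ 2 + 512 * sn ^+ 2 * signal.
  apply: (le_trans (ler_sum _ (fun i _ => bound1 i))).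
  by rewrite big_split /= sumr_const -[_ *+ #|_|]mulr_natr root_card_sqr -mulr_sumr.
have sum2 : \sum_i (w i * a i) ^+ 2 * clipped_var p m i (cutoff i) (m%:R * q i) <=
    2 * m%:R * signal + (2 ^+ 16 * sn ^+ 2) * signal + signal / 1024 * signal.
  apply: (le_trans (ler_sum _ (fun i _ => bound2 i))).
  by rewrite !big_split /= -!mulr_sumr.
have := mulr_ge0 (sqr_ge0 sn) signal_ge0.
nra.
Qed.

End Alternative.
End BatchStatistic.

(** * Numerical bounds on the exponential *)

Section ExpBounds.
Variable R : realType.

Lemma expRN1_le : expR (-1) <= 1 / 2 :> R.
Proof.
rewrite expRN div1r lef_pV2 ?posrE ?expR_gt0 //.
have := expR_ge1Dx (1 : R); lra.
Qed.

Lemma expR_half_le : expR (1 / 2) <= 2 :> R.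
Proof.
have := expR_ge1Dx (- (1 / 2) : R); rewrite expRN => h.
have e0 := expR_gt0 (1 / 2 : R).
have : expR (1 / 2) * (expR (1 / 2))^-1 = 1 :> R by rewrite mulfV // gt_eqF.
nra.
Qed.

Lemma expR1_le : expR 1 <= 4 :> R.
Proof.
have -> : (1 : R) = 1 / 2 + 1 / 2 by field.
by rewrite expRD; have := expR_half_le; have := expR_gt0 (1 / 2 : R); nra.
Qed.

(** Chebyshev in exponential form: [z] will be a normalised squared deviation, at least 1 unless the
    score is at its lower extreme. There the exponential is at most 1/2, elsewhere at most 4. *)
Lemma expR_clip_le (y z : R) :
  (-1 < y -> 1 <= z) -> 0 <= z -> expR (clip 1 y) <= 1 / 2 + 4 * z.
Proof.
move=> yz z0; case: (leP y (-1)) => y1.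
  suff -> : clip 1 y = -1 by have := expRN1_le; lra.
  by case: (clipP y ler01) => *; lra.
have /le_trans : expR (clip 1 y) <= expR 1.
  by rewrite ler_expR (le_trans (ler_norm _)) // ler_norm_clip.
apply; have := yz y1; have := expR1_le; lra.
Qed.

End ExpBounds.

(** * The batch score: sensitivity and exponential moments *)

Section BatchScore.
Variables (R : realType) (I : finType) (q : I -> R) (m : nat) (alpha : R).
Hypotheses (q_ge0 : forall t, 0 <= q t) (q_sum1 : \sum_t q t = 1).
Hypotheses (alpha_gt0 : 0 < alpha) (alpha_le1 : alpha <= 1).
Hypothesis m_large : 2 ^+ 15 * root_card R I <= m%:R * alpha ^+ 2.

Local Notation sn := (root_card R I).
Local Notation rho := (root_mass q).
Local Notation A := (strength m alpha).
Local Notation W := (A ^+ 2 / 16).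

(** A far alternative has signal at least [8 * W]. Centred at [2 * W] with scale [W], the score is
    -1 for statistics up to [W] and 1 from [3 * W] on. *)
Definition batch_score (s : seq I) : R :=
  clip 1 ((batch_stat q m alpha (take m s) (drop m s) - 2 * W) / W).

Let A_gt0 : 0 < A.
Proof.
have := strength_ge_card alpha_gt0 alpha_le1 m_large.
have := root_card_ge1 q_sum1; lra.
Qed.

Let W_gt0 : 0 < W. Proof. by rewrite divr_gt0 // exprn_gt0. Qed.

Lemma centered_lip i (j k : nat) :
  `|centered q m alpha i j - centered q m alpha i k| <= `|j%:R - k%:R|.
Proof.
rewrite /centered opprB addrA addrNK.
have T0 : 0 <= cutoff q m alpha i.
  by have := cutoff_ge q_ge0 q_sum1 alpha_gt0 alpha_le1 m_large i; lra.
apply: (le_trans (clip_lip _ _ T0)).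
by rewrite opprB addrA addrNK.
Qed.

Lemma centered_bound i k : `|centered q m alpha i k| <= 2 * cutoff q m alpha i.
Proof.
have T0 : 0 <= cutoff q m alpha i.
  by have := cutoff_ge q_ge0 q_sum1 alpha_gt0 alpha_le1 m_large i; lra.
apply: (le_trans (ler_normB _ _)); rewrite [leRHS]mulr_natl mulr2n.
apply: lerD; first exact: ler_norm_clip.
apply: (le_trans (ler_norm_expect q_ge0 _ _)).
rewrite -[leRHS](expect_cst q_sum1 m); apply: le_expect => // s _.
exact: ler_norm_clip.
Qed.

(** A product changes by at most [2 * cutoff i] times the change of the two counts; dividing by
    [rho i ^+ 2] leaves [16 * A / rho i <= 16 * A * sn], and [count_hamming] doubles it. *)
Lemma batch_stat_lip s1 s2 t1 t2 : size s1 = size t1 -> size s2 = size t2 ->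
  `|batch_stat q m alpha s1 s2 - batch_stat q m alpha t1 t2| <=
  32 * (A * sn) * (hamming s1 t1 + hamming s2 t2)%:R.
Proof.
move=> st1 st2.
pose d (s t : seq I) (i : I) : R := `|(count_mem i s)%:R - (count_mem i t)%:R|.
apply: (@le_trans _ _ (\sum_i 16 * (A * sn) * (d s1 t1 i + d s2 t2 i))); last first.
  rewrite -mulr_sumr big_split /= natrD.
  have := count_hamming R st1; have := count_hamming R st2.
  have := mulr_gt0 A_gt0 (lt_le_trans ltr01 (root_card_ge1 q_sum1)); nra.
rewrite /batch_stat /pair_stat -sumrB; apply: (le_trans (ler_norm_sum _ _ _)).
apply: ler_sum => i _; rewrite -mulrBr.
set g := centered q m alpha i.
have w0 : 0 < (rho i ^+ 2)^-1 by rewrite invr_gt0 exprn_gt0 // root_mass_gt0.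
have -> : 16 * (A * sn) * (d s1 t1 i + d s2 t2 i) = (rho i ^+ 2)^-1 *
    (2 * cutoff q m alpha i * (rho i * sn) * (d s1 t1 i + d s2 t2 i)).
  rewrite /cutoff; field; exact: lt0r_neq0 (root_mass_gt0 q_sum1 i).
rewrite normrM gtr0_norm // ler_pM2l //.
have rs := root_mass_card q_ge0 q_sum1 i.
have T0 : 0 < cutoff q m alpha i.
  by have := cutoff_ge q_ge0 q_sum1 alpha_gt0 alpha_le1 m_large i; lra.
apply: (@le_trans _ _ (2 * cutoff q m alpha i * (d s1 t1 i + d s2 t2 i))); last first.
  rewrite [_ * (rho i * sn) * _]mulrAC ler_peMr //.
  by apply: mulr_ge0; [rewrite mulr_ge0 // ltW | rewrite addr_ge0 ?normr_ge0].
have -> : g (count_mem i s1) * g (count_mem i s2) - g (count_mem i t1) * g (count_mem i t2)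
  = (g (count_mem i s1) - g (count_mem i t1)) * g (count_mem i s2)
  + g (count_mem i t1) * (g (count_mem i s2) - g (count_mem i t2)) by ring.
apply: (le_trans (ler_normD _ _)); rewrite !normrM mulrDr; apply: lerD.
  by rewrite mulrC; apply: ler_pM => //; [exact: centered_bound | exact: centered_lip].
by apply: ler_pM => //; [exact: centered_bound | exact: centered_lip].
Qed.

(** The scale [W = A ^+ 2 / 16] turns the constant [32 * A * sn] into [512 * sn / A]. *)
Lemma batch_score_lip eps s s' : 512 * sn <= eps * A ->
  size s = size s' ->
  `|batch_score s - batch_score s'| <= eps * (hamming s s')%:R.
Proof.
move=> epsA ss; apply: (le_trans (clip_lip _ _ ler01)).
rewrite -mulrBl opprB addrA subrK normrM [`|_^-1|]gtr0_norm ?invr_gt0 //.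
rewrite ler_pdivrMr // (hamming_cat m ss).
have st : size (take m s) = size (take m s') by rewrite !size_take ss.
have sd : size (drop m s) = size (drop m s') by rewrite !size_drop ss.
apply: (le_trans (batch_stat_lip st sd)).
set h := (_ + _)%:R; have h0 : 0 <= h by [].
rewrite [leRHS]mulrAC; apply: ler_wpM2r => //.
have A0 := A_gt0; nra.
Qed.

Lemma expect_batch (p : I -> R) (f : R -> R) :
  expect p (m + m) (fun s => f (batch_score s)) =
  expect p m (fun s => expect p m (fun s' =>
    f (clip 1 ((batch_stat q m alpha s s' - 2 * W) / W)))).
Proof.
rewrite expect_cat; apply: eq_expect => s sm; apply: eq_expect => s' _.
by rewrite /batch_score take_size_cat // drop_size_cat.
Qed.

Lemma expect2_affine (p : I -> R) (F : seq I -> seq I -> R) (b c : R) :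
  \sum_t p t = 1 ->
  expect p m (fun s => expect p m (fun s' => b + c * F s s')) =
  b + c * expect p m (fun s => expect p m (F s)).
Proof.
move=> p1; rewrite -[in RHS](expect_cst p1 m b) -expectZ -expectD.
by apply: eq_expect => s _; rewrite expectD expectZ expect_cst.
Qed.

Lemma expect_batch_null : expect q (m + m) (fun s => expR (batch_score s)) <= 3 / 4.
Proof.
have W0 := W_gt0; rewrite expect_batch.
have sig0 : signal q m alpha q = 0.
  by rewrite /signal big1 // => i _; rewrite /mean_gap subrr expr0n mulr0.
have := batch_stat_dev q_ge0 q_sum1 alpha_gt0 alpha_le1 m_large q_ge0 q_sum1.
rewrite sig0 expr0n !mulr0 mul0r !addr0 => dev.
apply: (@le_trans _ _ (expect q m (fun s => expect q m (fun s' =>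
    1 / 2 + 4 / W ^+ 2 * (batch_stat q m alpha s s' - 0) ^+ 2)))).
  apply: le_expect => // s _; apply: le_expect => // s' _.
  rewrite subr0 -mulrA [W ^- 2 * _]mulrC; apply: expR_clip_le; last first.
    by rewrite divr_ge0 ?sqr_ge0.
  (* A score above -1 means that the statistic exceeds [W]. *)
  rewrite ltr_pdivlMr // ler_pdivlMr ?exprn_gt0 // => ZW; nra.
rewrite expect2_affine // -lerBrDl.
have -> : 3 / 4 - 1 / 2 = 1 / 4 :> R by field.
rewrite mulrAC ler_pdivrMr ?exprn_gt0 //.
apply: (@le_trans _ _ (4 * (16 * m%:R ^+ 2 * sn ^+ 2))); first by rewrite ler_pM2l.
have sA := strength_ge m_large; have sn1 := root_card_ge1 q_sum1.
rewrite (_ : 1 / 4 * W ^+ 2 = m%:R ^+ 2 * (A * alpha) ^+ 2 / 1024); last first.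
  by rewrite /strength; field.
have : 256 ^+ 2 * sn ^+ 2 <= (A * alpha) ^+ 2.
  by rewrite -exprMn ler_pXn2r // ?nnegrE; lra.
have := sqr_ge0 (m%:R : R); nra.
Qed.

Lemma expect_batch_alt (p : I -> R) :
  (forall t, 0 <= p t) -> \sum_t p t = 1 ->
  2 * alpha <= \sum_i `|p i - q i| ->
  expect p (m + m) (fun s => expR (- batch_score s)) <= 3 / 4.
Proof.
move=> p0 p1 far; have W0 := W_gt0; rewrite (expect_batch p (fun x => expR (- x))).
have := signal_large q_ge0 q_sum1 alpha_gt0 alpha_le1 m_large p0 p1 far.
have := batch_stat_dev q_ge0 q_sum1 alpha_gt0 alpha_le1 m_large p0 p1.
set S := signal q m alpha p => dev SA.
have S0 : 0 < S by have := W0; lra.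
apply: (@le_trans _ _ (expect p m (fun s => expect p m (fun s' =>
    1 / 2 + 16 / S ^+ 2 * (batch_stat q m alpha s s' - S) ^+ 2)))).
  apply: le_expect => // s _; apply: le_expect => // s' _.
  (* A negated score above -1 means a statistic below [3 * W <= 3 * S / 8], hence more than [S / 2]
     away from [S]. *)
  have -> : 16 / S ^+ 2 * (batch_stat q m alpha s s' - S) ^+ 2 =
    4 * (4 * (batch_stat q m alpha s s' - S) ^+ 2 / S ^+ 2) by field; lra.
  rewrite -clipN // -mulNr; apply: expR_clip_le; last first.
    by apply: divr_ge0; rewrite ?sqr_ge0 // pmulr_rge0 ?sqr_ge0.
  rewrite ltr_pdivlMr // ler_pdivlMr ?exprn_gt0 // => ZW.
  have : 0 < S - 2 * batch_stat q m alpha s s' by lra.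
  nra.
rewrite expect2_affine // -lerBrDl.
have -> : 3 / 4 - 1 / 2 = 1 / 4 :> R by field.
rewrite mulrAC ler_pdivrMr ?exprn_gt0 //.
have sA := strength_ge m_large; have sn1 := root_card_ge1 q_sum1.
have sA' := strength_ge_card alpha_gt0 alpha_le1 m_large.
have m0 : 0 <= m%:R :> R by [].
have A2 : m%:R * (2 ^+ 15 * sn) <= A ^+ 2.
  by rewrite (strength_sqr m alpha) ler_wpM2l.
have A2' : (2 ^+ 15 * sn) ^+ 2 <= A ^+ 2 by rewrite ler_pXn2r // ?nnegrE; lra.
(* Each deviation term is compared with [S ^+ 2], so that [16 / S ^+ 2] times their sum stays below
   1/4. *)
have msn : m%:R * sn <= S / 2 ^+ 14 by rewrite ler_pdivlMr //; lra.
have msn0 : 0 <= m%:R * sn by rewrite mulr_ge0 //; lra.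
have b1 : m%:R ^+ 2 * sn ^+ 2 <= S ^+ 2 / 2 ^+ 28.
  rewrite -exprMn (_ : S ^+ 2 / 2 ^+ 28 = (S / 2 ^+ 14) ^+ 2); last by field.
  by rewrite ler_pXn2r // ?nnegrE; lra.
have b2 : sn ^+ 2 * S <= S ^+ 2 / 2 ^+ 29.
  rewrite [S ^+ 2]expr2 [leRHS]mulrAC ler_pM2r // ler_pdivlMr //.
  by move: A2'; rewrite exprMn; lra.
have b3 : m%:R * S <= S ^+ 2 / 2 ^+ 14.
  rewrite [S ^+ 2]expr2 [leRHS]mulrAC ler_pM2r //; apply: le_trans msn.
  by rewrite ler_peMr.
have := sqr_ge0 S; lra.
Qed.

End BatchScore.

(** * Summing scores over batches *)

Section TotalScore.
Variables (R : realType) (I : finType) (M : nat) (u : seq I -> R).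

Fixpoint total_score (K : nat) (s : seq I) : R :=
  if K is K'.+1 then u (take M s) + total_score K' (drop M s) else 0.

Lemma total_score_lip eps K (s s' : seq I) :
  (forall t t', size t = size t' -> `|u t - u t'| <= eps * (hamming t t')%:R) ->
  0 <= eps -> size s = size s' ->
  `|total_score K s - total_score K s'| <= eps * (hamming s s')%:R.
Proof.
move=> ulip eps0; elim: K s s' => [|K IH] s s' ss /=.
  by rewrite subrr normr0 mulr_ge0.
rewrite opprD addrACA (hamming_cat M ss) natrD mulrDr.
apply: (le_trans (ler_normD _ _)); apply: lerD.
  by apply: ulip; rewrite !size_take ss.
by apply: IH; rewrite !size_drop ss.
Qed.

(** Disjoint blocks are independent, so exponential moments multiply; [c] will be 1 in the null case
    and -1 for alternatives. *)
Lemma expect_total_score (p : I -> R) (c theta : R) K :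
  (forall t, 0 <= p t) -> \sum_t p t = 1 -> 0 <= theta ->
  expect p M (fun s => expR (c * u s)) <= theta ->
  expect p (K * M) (fun s => expR (c * total_score K s)) <= theta ^+ K.
Proof.
move=> p0 p1 th0 hu; elim: K => [|K IH] /=; first by rewrite mulr0 expR0.
rewrite mulSn expect_cat.
have -> : expect p M (fun s => expect p (K * M) (fun s' =>
    expR (c * (u (take M (s ++ s')) + total_score K (drop M (s ++ s')))))) =
    expect p (K * M) (fun s => expR (c * total_score K s)) *
    expect p M (fun s => expR (c * u s)).
  rewrite -expectZ; apply: eq_expect => s sm; rewrite mulrC -expectZ.
  apply: eq_expect => s' _; rewrite take_size_cat // drop_size_cat //.
  by rewrite mulrDr expRD.
rewrite exprSr; apply: ler_pM => //;
  by apply: expect_ge0 => // s _; exact: expR_ge0.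
Qed.

End TotalScore.

(** * Sample sequences as finite functions *)

Lemma expect_ffun (R : realType) (T : finType) (p : T -> R) m (F : seq T -> R) :
  \sum_(x : {ffun 'I_m -> T}) (\prod_(j < m) p (x j)) * F (codom x) = expect p m F.
Proof.
elim: m F => [|m IH] F /=.
  have x0 : {ffun 'I_0 -> T} by apply: finfun => -[].
  rewrite (bigD1 x0) //= big_ord0 mul1r big1 ?addr0 => [|x /eqP[]].
    by rewrite (size0nil (_ : size (codom x0) = 0%N)) ?size_codom ?card_ord.
  by apply/ffunP => -[].
pose h (tx : T * {ffun 'I_m -> T}) : {ffun 'I_m.+1 -> T} :=
  [ffun j => oapp tx.2 tx.1 (unlift ord0 j)].
pose h' (f : {ffun 'I_m.+1 -> T}) := (f ord0, [ffun j => f (lift ord0 j)]).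
have hK : cancel h h'.
  move=> [t x]; rewrite /h' /h ffunE unlift_none /=; congr (_, _).
  by apply/ffunP => j; rewrite !ffunE liftK.
have h'K : cancel h' h.
  move=> f; apply/ffunP => j; rewrite ffunE /=.
  by case: unliftP => [k ->|->] //=; rewrite ffunE.
rewrite (reindex h) /=; last by exists h' => ? _; [exact: hK | exact: h'K].
rewrite -(pair_bigA _ (fun t x => \prod_j p (h (t, x) j) * F (codom (h (t, x))))) //=.
apply: eq_bigr => t _; rewrite -IH big_distrr /=; apply: eq_bigr => x _.
rewrite big_ord_recl mulrA /h ffunE unlift_none /=; congr (_ * _ * F _).
  by apply: eq_bigr => j _; rewrite ffunE liftK.
rewrite /codom /image_mem enum_ordSl /= ffunE unlift_none /= -map_comp.
by congr (_ :: _); apply: eq_map => j /=; rewrite ffunE liftK.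
Qed.

Lemma hamming_codom m (T : finType) (x y : {ffun 'I_m -> T}) :
  hamming (codom x) (codom y) = #|[set j | x j != y j]|.
Proof.
rewrite /hamming /codom /image_mem zip_map count_map cardE -size_filter.
by rewrite enumT; congr size; apply: eq_filter => j; rewrite !inE.
Qed.

(** * Averaging over the orderings of the samples *)

Section Symmetrization.
Variables (n m : nat).
Implicit Types x y : {ffun 'I_m -> 'I_n}.

Definition permute x (s : 'S_m) : {ffun 'I_m -> 'I_n} := [ffun j => x (s j)].

Lemma counts_permute y s : counts (permute y s) = counts y.
Proof.
apply/ffunP => i; rewrite !ffunE -(card_imset _ (@perm_inj _ s)).
congr #|pred_of_set _|; apply/setP => j; rewrite !inE; apply/imsetP/idP.
  by move=> [k]; rewrite inE ffunE => yk ->.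
by move=> yj; exists ((s^-1)%g j); rewrite ?permKV // inE ffunE permKV.
Qed.

(* In an optimal alignment no value of x on the disagreement set J occurs
   among the values of y on J, as a transposition would improve it. *)
Lemma exists_alignment x y :
  exists s : 'S_m, (#|[set j | x j != permute y s j]| <= dist1 (counts x) (counts y))%N.
Proof.
pose diff s := [set j | x j != permute y s j].
case: (arg_minnP (P := xpredT) (i0 := (1%g : 'S_m)) (fun s => #|diff s|)) => // s _ smin.
exists s; rewrite -/(diff s) -(counts_permute y s); set z := permute y s.
have disj j k : j \in diff s -> k \in diff s -> x j != z k.
  move=> jJ kJ; apply/eqP => xz.
  pose s' := (tperm j k * s)%g.
  suff : (diff s' \proper diff s).
    by move=> /proper_card; rewrite ltnNge smin.
  apply/properP; split; last first.
    by exists j => //; rewrite !inE ffunE permM tpermL xz /z ffunE eqxx.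
  apply/fintype.subsetP => l; rewrite inE ffunE permM.
  case: tpermP => [-> _|->|_ _] //.
  by rewrite inE ffunE.
have cnt (f : {ffun 'I_m -> 'I_n}) i :
    #|[set j | f j == i]| = (#|[set j in diff s | f j == i]| +
      #|[set j | (j \notin diff s) && (f j == i)]|)%N.
  rewrite -(cardsID (diff s)); congr (_ + _)%N; apply: eq_card => j.
    by rewrite !inE andbC.
  by rewrite finset.in_setD !inE.
have -> : #|diff s| = (\sum_i #|[set j in diff s | x j == i]|)%N.
  rewrite -sum1_card (partition_big x xpredT) //=; apply: eq_bigr => i _.
  by rewrite -sum1_card; apply: eq_bigl => j; rewrite !inE.
apply: leq_sum => i _; rewrite !ffunE !cnt.
have -> : #|[set j | (j \notin diff s) && (z j == i)]|
    = #|[set j | (j \notin diff s) && (x j == i)]|.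
  apply: eq_card => j; rewrite !inE negbK.
  by case: eqP => //= ->.
(* If [x] takes the value [i] on the disagreement set, then [z] does not, so the two counts of [i]
   differ by exactly the number of such positions. *)
have [->|[j]] := finset.set_0Vmem [set j in diff s | x j == i].
  by rewrite cards0.
rewrite inE => /andP[jJ /eqP xj].
have -> : [set j in diff s | z j == i] = finset.set0.
  apply/setP => k; rewrite finset.in_set0 inE; apply/negP => /andP[kJ /eqP zk].
  by have := disj j k jJ kJ; rewrite xj zk eqxx.
rewrite cards0 add0n PoszD addrK absz_nat //.
Qed.

Variable R : realType.
Variables (eps : R) (U : {ffun 'I_m -> 'I_n} -> R).
Hypothesis eps_gt0 : 0 < eps.
Hypothesis U_lip : forall x y, `|U x - U y| <= eps * #|[set j | x j != y j]|%:R.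

Definition average x : R := (\sum_(s : 'S_m) U (permute x s)) / #|{: 'S_m}|%:R.

Let N_gt0 : 0 < #|{: 'S_m}|%:R :> R.
Proof. by rewrite ltr0n; apply/card_gt0P; exists 1%g. Qed.

Lemma average_permute x s : average (permute x s) = average x.
Proof.
congr (_ / _); rewrite [RHS](reindex_inj (mulIg s)) /=.
by apply: eq_bigr => t _; congr U; apply/ffunP => j; rewrite !ffunE permM.
Qed.

Lemma average_lip x y : average x <= average y + eps * #|[set j | x j != y j]|%:R.
Proof.
rewrite -lerBlDl -mulrBl ler_pdivrMr // -sumrB.
apply: (@le_trans _ _ (\sum_(s : 'S_m) eps * #|[set j | x j != y j]|%:R)); last first.
  by rewrite sumr_const -[_ *+ #|_|]mulr_natr.
apply: ler_sum => s _; apply: (le_trans (ler_norm _)); apply: (le_trans (U_lip _ _)).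
rewrite ler_pM2l // ler_nat -(card_imset _ (@perm_inj _ s)).
apply/subset_leq_card/fintype.subsetP => j /imsetP[k].
by rewrite !inE !ffunE => xy ->.
Qed.

(** The average ignores order, so [y] may first be aligned with [x]; the Hamming distance left is at
    most the distance of the counts. *)
Lemma average_counts x y :
  average x <= average y + eps * (dist1 (counts x) (counts y))%:R.
Proof.
have [s hs] := exists_alignment x y; rewrite -(average_permute y s).
by apply: (le_trans (average_lip x (permute y s))); rewrite lerD2l ler_pM2l // ler_nat.
Qed.

Lemma expR_average (p : 'I_n -> R) (c : R) : (forall i, 0 <= p i) ->
  \sum_(x : {ffun 'I_m -> 'I_n}) (\prod_(j < m) p (x j)) * expR (c * average x) <=
  \sum_(x : {ffun 'I_m -> 'I_n}) (\prod_(j < m) p (x j)) * expR (c * U x).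
Proof.
move=> p0; have P0 x : 0 <= \prod_(j < m) p (x j) by rewrite prodr_ge0.
(* Jensen, from the tangent of the exponential at the averaged exponent [l]: the linear terms cancel
   in the sum over permutations. *)
have jensen x : expR (c * average x) <=
    (\sum_(s : 'S_m) expR (c * U (permute x s))) / #|{: 'S_m}|%:R.
  rewrite ler_pdivlMr //; set l := c * average x; set e := expR l.
  have e0 : 0 <= e by exact: expR_ge0.
  apply: (@le_trans _ _ (\sum_(s : 'S_m) e * (1 + (c * U (permute x s) - l)))).
    rewrite -mulr_sumr; apply: ler_wpM2l => //.
    rewrite big_split sumrB /= !sumr_const -mulr_sumr.
    rewrite -[l *+ _]mulr_natr /l -mulrA /average divfK ?gt_eqF //.
    by rewrite subrr addr0.
  apply: ler_sum => s _; rewrite -[X in _ <= expR X](subrKC l) expRD.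
  by apply: ler_wpM2l => //; exact: expR_ge1Dx.
apply: (@le_trans _ _ (\sum_(x : {ffun 'I_m -> 'I_n}) (\prod_(j < m) p (x j)) *
  ((\sum_(s : 'S_m) expR (c * U (permute x s))) / #|{: 'S_m}|%:R))).
  by apply: ler_sum => x _; apply: ler_wpM2l.
under eq_bigr do rewrite mulrA; rewrite -mulr_suml ler_pdivrMr //.
under eq_bigr do rewrite mulr_sumr; rewrite exchange_big /=.
rewrite mulr_natr -sumr_const; apply: ler_sum => s _; rewrite le_eqVlt.
apply/orP; left; apply/eqP.
(* An i.i.d. sample keeps its law under permutation, so every ordering contributes the same sum. *)
have pK : cancel (permute^~ s) (permute^~ (s^-1)%g).
  by move=> x; apply/ffunP => j; rewrite !ffunE permKV.
rewrite [RHS](reindex_inj (can_inj pK)) /=; apply: eq_bigr => x _.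
congr (_ * _); rewrite (reindex_inj (@perm_inj _ s)) /=.
by apply: eq_bigr => j _; rewrite ffunE.
Qed.

End Symmetrization.

(** * The logistic mechanism: privacy and accuracy *)

Section Mechanism.
Variable R : realType.

Lemma dist1_triangle n (D E F : {ffun 'I_n -> nat}) :
  (dist1 D F <= dist1 D E + dist1 E F)%N.
Proof.
rewrite /dist1 -big_split; apply: leq_sum => i _; exact: leqD_dist.
Qed.

Lemma dist1_eq0 n (D : {ffun 'I_n -> nat}) : dist1 D D = 0%N.
Proof. by rewrite /dist1 big1 // => i _; rewrite subrr. Qed.

Lemma dist1C n (D E : {ffun 'I_n -> nat}) : dist1 D E = dist1 E D.
Proof. by apply: eq_bigr => i _; rewrite distnC. Qed.

Definition sigmoid (z : R) : R := (1 + expR (- z))^-1.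

Lemma sigmoid_gt0 z : 0 < sigmoid z.
Proof. by rewrite invr_gt0; have := expR_gt0 (- z); lra. Qed.

Lemma sigmoidD z : sigmoid z + sigmoid (- z) = 1.
Proof.
rewrite /sigmoid opprK expRN; have := expR_gt0 z => ez.
by field; apply/andP; split; apply: lt0r_neq0; lra.
Qed.

Lemma sigmoid_le z : sigmoid z <= expR z.
Proof.
rewrite -[expR z]invrK -expRN lef_pV2 ?posrE; have := expR_gt0 (- z); lra.
Qed.

(** The logarithm of the logistic function is increasing and 1-Lipschitz, so a shift by [eps] costs
    a factor [e^eps] and no additive loss. *)
Lemma sigmoid_lip (eps z z' : R) : 0 <= eps -> z <= z' + eps ->
  sigmoid z <= expR eps * sigmoid z'.
Proof.
move=> eps0 zz; rewrite /sigmoid -[expR eps]invrK -expRN -invfM.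
have e1 := expR_gt0 (- eps); have e2 := expR_gt0 (- z); have e3 := expR_gt0 (- z').
rewrite lef_pV2 ?posrE ?mulr_gt0 //; try lra.
have : expR (- eps) <= 1 by rewrite -expR0 ler_expR; lra.
have : expR (- eps) * expR (- z') <= expR (- z) by rewrite -expRD ler_expR; lra.
lra.
Qed.

Definition logistic n (L : {ffun 'I_n -> nat} -> R) (D : {ffun 'I_n -> nat}) :
  {ffun bool -> R} := [ffun o : bool => sigmoid (if o then L D else - L D)].

Lemma logistic_randomized n (L : {ffun 'I_n -> nat} -> R) : randomized (logistic L).
Proof.
move=> D; split; first by move=> o; rewrite ffunE ltW ?sigmoid_gt0.
by rewrite big_bool /= !ffunE sigmoidD.
Qed.

Lemma logistic_private n (L : {ffun 'I_n -> nat} -> R) eps : 0 <= eps ->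
  (forall D D', (dist1 D D' <= 1)%N -> L D <= L D' + eps) ->
  diff_private eps 0 (logistic L).
Proof.
move=> eps0 Llip D D' DD S; rewrite addr0 mulr_sumr; apply: ler_sum => o _.
rewrite !ffunE; apply: sigmoid_lip => //; case: o; first exact: Llip.
have := Llip D' D; rewrite dist1C => /(_ DD); lra.
Qed.

Variables (n m : nat) (eps : R) (U : {ffun 'I_m -> 'I_n} -> R) (i0 : 'I_n).
Hypothesis eps_gt0 : 0 < eps.
Hypothesis U_lip : forall x y, `|U x - U y| <= eps * #|[set j | x j != y j]|%:R.

Let V (D : {ffun 'I_n -> nat}) (x : {ffun 'I_m -> 'I_n}) : R :=
  average U x + eps * (dist1 D (counts x))%:R.

(* McShane extension of [average U] from datasets of size m to all datasets. *)
Definition extension (D : {ffun 'I_n -> nat}) : R :=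
  V D [arg min_(x < ([ffun=> i0] : {ffun 'I_m -> 'I_n})) V D x]%O.

Lemma extension_le D x : extension D <= V D x.
Proof. by rewrite /extension; case: arg_minP => // y _ /(_ x); exact. Qed.

Lemma extension_lip D D' : (dist1 D D' <= 1)%N -> extension D <= extension D' + eps.
Proof.
move=> DD; rewrite {2}/extension; set x := [arg min_(_ < _) _]%O.
apply: (le_trans (extension_le D x)); rewrite /V -addrA lerD2l.
rewrite -[X in _ + X]mulr1 -mulrDr ler_pM2l // natr1 ler_nat.
by apply: (leq_trans (dist1_triangle D D' _)); rewrite -addn1 addnC leq_add2l.
Qed.

Lemma extension_counts x : extension (counts x) = average U x.
Proof.
apply/eqP; rewrite eq_le; apply/andP; split.
  by apply: (le_trans (extension_le _ x)); rewrite /V dist1_eq0 mulr0 addr0.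
exact: (average_counts eps_gt0 U_lip).
Qed.

(** The wrong output has as probability the sigmoid of the signed average, which its exponential
    dominates; [expR_average] then passes to [U]. The exponent [o] is the boolean read as 0 or 1. *)
Lemma logistic_output (p : {ffun 'I_n -> R}) (o : bool) : is_dist p ->
  1 - \sum_(x : {ffun 'I_m -> 'I_n}) (\prod_(j < m) p (x j)) * expR ((-1) ^+ o * U x)
  <= prob_out m p (logistic extension) o.
Proof.
move=> [p0 p1].
apply: (@le_trans _ _ (1 - \sum_(x : {ffun 'I_m -> 'I_n}) (\prod_(j < m) p (x j)) *
    expR ((-1) ^+ o * average U x))).
  by rewrite lerD2l lerN2; exact: expR_average.
have total : \sum_(x : {ffun 'I_m -> 'I_n}) \prod_(j < m) p (x j) = 1.
  rewrite -[RHS](expect_cst p1 m) -expect_ffun.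
  by apply: eq_bigr => x _; rewrite mulr1.
rewrite -[X in X - _ <= _]total -sumrB; apply: ler_sum => x _.
rewrite -[X in X - _]mulr1 -mulrBr.
apply: ler_wpM2l; first by rewrite prodr_ge0.
rewrite ffunE extension_counts; case: o => /=.
  rewrite expr1 mulN1r lerBlDr; have := sigmoid_le (- average U x).
  by have := sigmoidD (average U x); lra.
rewrite expr0 mul1r lerBlDr; have := sigmoid_le (average U x).
by have := sigmoidD (average U x); lra.
Qed.

End Mechanism.

(** * Assembly of the tester and the sample count *)

Lemma trivial_tester (R : realType) n (q : {ffun 'I_n -> R}) (eps alpha betaI betaII : R) :
  0 < eps -> is_dist q -> 1 / 2 <= betaI -> 1 / 2 <= betaII ->
  exists M, [/\ randomized M, diff_private eps 0 M &
    identity_tester q alpha betaI betaII 0 M].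
Proof.
move=> eps0 qd bI bII; exists (fun=> [ffun=> 1 / 2 : R]).
have out p o : is_dist p -> prob_out 0 p (fun=> [ffun=> 1 / 2 : R]) o = 1 / 2.
  move=> [p0 p1]; rewrite -[RHS](expect_cst p1 0) -expect_ffun.
  by apply: eq_bigr => x _; rewrite ffunE.
split.
- move=> D; split; first by move=> o; rewrite ffunE; lra.
  by rewrite big_bool /= !ffunE; lra.
- move=> D D' _ S; rewrite addr0 ler_peMl //.
    by apply: sumr_ge0 => o _; rewrite ffunE; lra.
  by have := expR_ge1Dx eps; lra.
- split; first by rewrite out //; lra.
  by move=> p pd _; rewrite out //; lra.
Qed.

Lemma sqrt_rate_tester (R : realType) n m K (q : {ffun 'I_n -> R})
  (eps alpha betaI betaII : R) :
  (0 < n)%N -> 0 < eps -> 0 < alpha <= 1 -> is_dist q ->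
  2 ^+ 15 * Num.sqrt n%:R <= m%:R * alpha ^+ 2 ->
  512 * Num.sqrt n%:R <= eps * (m%:R * alpha) ->
  (3 / 4) ^+ K <= betaI -> (3 / 4) ^+ K <= betaII ->
  exists M, [/\ randomized M, diff_private eps 0 M &
    identity_tester q alpha betaI betaII (K * (m + m)) M].
Proof.
move=> n0 eps0 /andP[al0 al1] [q0 q1] m1 m2 KI KII.
have rc : root_card R 'I_n = Num.sqrt n%:R by rewrite /root_card card_ord.
rewrite -rc in m1 m2.
pose u := batch_score q m alpha.
pose U (x : {ffun 'I_(K * (m + m)) -> 'I_n}) := total_score (m + m) u K (codom x).
have Ulip x y : `|U x - U y| <= eps * #|[set j | x j != y j]|%:R.
  rewrite -hamming_codom; apply: total_score_lip; last by rewrite !size_codom.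
    by move=> t t'; apply: batch_score_lip.
  exact: ltW.
exists (logistic (extension eps U (Ordinal n0))); split.
- exact: logistic_randomized.
- by apply: logistic_private; [exact: ltW | exact: extension_lip].
have th0 : 0 <= 3 / 4 :> R by lra.
split.
  apply: le_trans (logistic_output _ eps0 Ulip false (conj q0 q1)).
  rewrite lerD2l lerN2; apply: le_trans KI.
  under eq_bigr do rewrite expr0.
  rewrite (expect_ffun q _ (fun s => expR (1 * total_score (m + m) u K s))).
  apply: expect_total_score => //.
  rewrite -[leLHS](_ : expect q (m + m) (fun s => expR (u s)) = _); last first.
    by apply: eq_expect => s _; rewrite mul1r.
  exact: expect_batch_null.
move=> p pd far; apply: le_trans (logistic_output _ eps0 Ulip true pd).
case: pd => p0 p1; rewrite lerD2l lerN2; apply: le_trans KII.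
under eq_bigr do rewrite expr1.
rewrite (expect_ffun p _ (fun s => expR (-1 * total_score (m + m) u K s))).
apply: expect_total_score => //.
rewrite -[leLHS](_ : expect p (m + m) (fun s => expR (- u s)) = _); last first.
  by apply: eq_expect => s _; rewrite mulN1r.
apply: expect_batch_alt => //; move: far; rewrite /dTV; lra.
Qed.

(** As [alpha <= 1], [alpha^(3/2) <= alpha], so the sensitivity requirement [sqrt n / (alpha * eps)]
    lies below the second term of the maximum. *)
Lemma sample_main_ge (R : realType) n (eps alpha : R) : 0 < eps -> 0 < alpha <= 1 ->
  Num.sqrt n%:R / alpha ^+ 2 <= sample_main n eps alpha /\
  Num.sqrt n%:R / (alpha * eps) <= sample_main n eps alpha.
Proof.
move=> eps0 al; have /andP[al0 al1] := al.
rewrite /sample_main; split; first by rewrite !le_max lexx.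
rewrite !le_max; apply/orP; left; apply/orP; right.
apply: ler_wpM2l => //; rewrite lef_pV2 ?posrE ?mulr_gt0 ?powR_gt0 //.
rewrite ler_pM2r // -[leRHS]powRr1; last exact: ltW.
by apply: ger_powR => //; lra.
Qed.

Lemma exp_rounds (R : realType) (beta : R) : 0 < beta < 1 / 2 ->
  exists K : nat, (3 / 4) ^+ K <= beta /\ K%:R <= 6 * ln beta^-1.
Proof.
move=> /andP[b0 b1].
(* This lower bound on the logarithm lets [2 * L] absorb the 1 added by rounding. *)
have L0 : 1 / 2 <= ln beta^-1.
  have h : 2 <= beta^-1 by rewrite -[leLHS]invrK lef_pV2 ?posrE //; lra.
  have e1 := expR_half_le R.
  by rewrite -[leLHS]expRK ler_ln ?posrE ?expR_gt0 ?invr_gt0 //; lra.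
set L := ln beta^-1 in L0 *.
have L4 : 0 <= 4 * L by lra.
exists (Num.truncn (4 * L)).+1; split; last first.
  by have /andP[tL _] := truncn_itv L4; rewrite -natr1; lra.
have e34 : 3 / 4 <= expR (- (1 / 4)) :> R by have := expR_ge1Dx (- (1 / 4) : R); lra.
apply: (@le_trans _ _ (expR (- (1 / 4)) ^+ (Num.truncn (4 * L)).+1)).
  by rewrite ler_pXn2r // ?nnegrE ?expR_ge0 //; lra.
rewrite -expRM_natl -[leRHS](lnK (x := beta)) ?posrE // ler_expR.
have := truncnS_gt (4 * L); rewrite {1}/L lnV ?posrE //; lra.
Qed.

Theorem theorem3 (R : realType) :
  exists (C : R) (k : nat), 0 < C /\
  forall (n : nat) (eps alpha betaI betaII : R),
    (1 <= n)%N -> 0 < eps -> 0 < alpha <= 1 ->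
    0 < betaI < 1 -> 0 < betaII < 1 ->
    forall q : {ffun 'I_n -> R}, is_dist q ->
    exists (m : nat) (M : {ffun 'I_n -> nat} -> {ffun bool -> R}),
      [/\ randomized M, diff_private eps 0 M,
          identity_tester q alpha betaI betaII m M &
          m%:R <= C * sample_main n eps alpha * ln (Num.min betaI betaII)^-1
                    * (1 + ln n%:R) ^+ k].
Proof.
(* The constant covers [6 * (2 ^+ 16 + 1026)]: at most [6 * ln beta^-1] batches of [2 * m] samples,
   with [m <= (2 ^+ 15 + 513) * S]. *)
exists (2 ^+ 19), 0%N; split; first by rewrite exprn_gt0.
move=> n eps alpha betaI betaII n1 eps0 al /andP[bI0 bI1] /andP[bII0 bII1] q qd.
have /andP[al0 al1] := al; have [s1 s2] := sample_main_ge n eps0 al.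
set S := sample_main n eps alpha in s1 s2 *.
set sn := Num.sqrt n%:R in s1 s2.
have sn1 : 1 <= sn by rewrite -sqrtr1 ler_sqrt // ler1n.
have S1 : 1 <= S.
  apply: (le_trans _ s1); rewrite ler_pdivlMr ?exprn_gt0 // mul1r.
  by apply: (le_trans _ sn1); rewrite expr_le1 // ltW.
set beta := Num.min betaI betaII.
have beta0 : 0 < beta by rewrite lt_min bI0.
have beta1 : beta < 1 by rewrite gt_min bI1.
have lnb : 0 <= ln beta^-1 by rewrite ln_ge0 // invf_ge1 // ltW.
(* The bound tends to 0 as [beta] tends to 1, so for [beta >= 1/2] a fair coin without samples is
   used. *)
case: (leP (1 / 2) beta) => [|bh].
  rewrite le_min => /andP[hI hII].
  have [M [M1 M2 M3]] := trivial_tester alpha eps0 qd hI hII.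
  by exists 0%N, M; split=> //; rewrite expr0 mulr1 mulr_ge0 ?mulr_ge0 //; lra.
have [K [Kb KL]] : exists K : nat, (3 / 4) ^+ K <= beta /\ K%:R <= 6 * ln beta^-1.
  by apply: exp_rounds; rewrite beta0.
(* The sum of the two lower bounds required of [m]; rounding up costs at most 1, which [S >= 1]
   absorbs. *)
pose X := 2 ^+ 15 * (sn / alpha ^+ 2) + 512 * (sn / (alpha * eps)).
have sn0 : 0 <= sn by lra.
have X1 : 0 <= sn / alpha ^+ 2 by rewrite divr_ge0 ?exprn_ge0 // ltW.
have X2 : 0 <= sn / (alpha * eps) by rewrite divr_ge0 ?mulr_ge0 // ltW.
have X0 : 0 <= X by rewrite /X; lra.
pose m := (Num.truncn X).+1.
have mX : X < m%:R by exact: truncnS_gt.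
have mS : m%:R <= 2 ^+ 15 * S + 512 * S + S.
  have /andP[tX _] := truncn_itv X0; move: tX; rewrite /m -natr1 {2}/X; lra.
have m1 : 2 ^+ 15 * sn <= m%:R * alpha ^+ 2.
  by rewrite -ler_pdivrMr ?exprn_gt0 // -mulrA; move: mX; rewrite /X; lra.
have m2 : 512 * sn <= eps * (m%:R * alpha).
  rewrite mulrCA [eps * _]mulrC -ler_pdivrMr ?mulr_gt0 // -mulrA.
  by move: mX; rewrite /X; lra.
move: Kb; rewrite le_min => /andP[KI KII].
have [M [M1 M2 M3]] := sqrt_rate_tester n1 eps0 al qd m1 m2 KI KII.
exists (K * (m + m))%N, M; split=> //; rewrite expr0 mulr1 natrM natrD.
have K0 : 0 <= K%:R :> R by [].
have : K%:R * (m%:R + m%:R) <= (6 * ln beta^-1) * (2 ^+ 16 * S + 1026 * S).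
  by apply: ler_pM => //; lra.
have := mulr_ge0 lnb (_ : 0 <= S); nra.
Qed.
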